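(* Let $D_1$ be a periodic first-derivative SBP operator and $D_2$ a periodic second-derivative SBP operator on the same grid with $N$ nodes and with the same diagonal mass matrix $M$. Let $g>0$, let $\boldsymbol b\in\mathbb R^N$ be the bathymetry vector (constant in time), and let $\boldsymbol{\hat\alpha},\boldsymbol{\hat\beta},\boldsymbol{\hat\gamma}\in\mathbb R^N$ be the coefficient vectors given in the context. Consider the semidiscretization for $\boldsymbol h(t),\boldsymbol v(t)\in\mathbb R^N$ with $\boldsymbol h>0$ componentwise and $\boldsymbol P=\boldsymbol h\boldsymbol v$: $$\boldsymbol h_t=-D_1(\boldsymbol h\boldsymbol v)+D_1\boldsymbol y,$$ $$\begin{aligned}(\boldsymbol h\boldsymbol v)_t={}&-\tfrac12\big(D_1(\boldsymbol h\boldsymbol v^2)+\boldsymbol h\boldsymbol vD_1\boldsymbol v+\boldsymbol vD_1(\boldsymbol h\boldsymbol v)\big)-g\boldsymbol hD_1(\boldsymbol h+\boldsymbol b)\\&+\tfrac12\big(D_1(\boldsymbol v\boldsymbol y)+\boldsymbol vD_1\boldsymbol y+\boldsymbol yD_1\boldsymbol v\big)+D_1(\boldsymbol{\hat\beta}D_1\boldsymbol v_t)+\tfrac12D_2(\boldsymbol{\hat\gamma}D_1\boldsymbol v)+\tfrac12D_1(\boldsymbol{\hat\gamma}D_2\boldsymbol v),\end{aligned}$$ where $\boldsymbol y=\boldsymbol{\hat\alpha}D_1(\boldsymbol{\hat\alpha}D_1(\boldsymbol h+\boldsymbol b))$. Then, along every solution: (1) the total mass $\mathcal M(t)=\boldsymbol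 1^TM\boldsymbol h$ is conserved; (2) if the bathymetry is constant ($\boldsymbol b=b_0\boldsymbol 1$), the total discharge $\mathcal I(t)=\boldsymbol 1^TM\boldsymbol P$ is conserved; (3) the total modified entropy $$\hat{\mathcal E}(t)=\boldsymbol 1^TM\Big(\tfrac12(\boldsymbol h\boldsymbol v^2+g\boldsymbol h^2)+g\boldsymbol h\boldsymbol b+\tfrac12\boldsymbol{\hat\beta}(D_1\boldsymbol v)^2\Big)$$ is conserved. Moreover, (4) the scheme is well-balanced: every lake-at-rest state $\boldsymbol v=\boldsymbol 0$, $\boldsymbol h+\boldsymbol b=c\,\boldsymbol 1$ with $c\in\mathbb R$ (and $\boldsymbol h>0$) is a stationary solution.
   Context: Products and powers of vectors in $\mathbb R^N$ are taken componentwise: $(\boldsymbol u\boldsymbol v)_j=u_jv_j$, $(\boldsymbol u^k)_j=u_j^k$; expressions such as $\boldsymbol vD_1\boldsymbol y$ mean the componentwise product of $\boldsymbol v$ and $D_1\boldsymbol y$. $\boldsymbol 1=(1,\dots,1)^T$, $\boldsymbol 0=(0,\dots,0)^T$. ''Conserved'' means that the time derivative vanishes along every (continuously differentiable in time) solution. A derivative matrix $A\in\mathbb R^{N\times N}$ is consistent if $A\boldsymbol 1=\boldsymbol 0$. A periodic first-derivative SBP (summation-by-parts) operator consists of a grid $\boldsymbol x$, a consistent first-derivative matrix $D_1$ and a symmetric positive-definite matrix $M$ with $MD_1+D_1^TM=0$. A periodic second-derivative SBP operator consists of a grid $\boldsymbol x$, a consistent second-derivative matrix $D_2$ and a symmetric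 positive-definite matrix $M$ with $MD_2=D_2^TM$. Throughout, $M$ is diagonal. Coefficients: with still water depth $\boldsymbol D=\eta_0\boldsymbol 1-\boldsymbol b$ (componentwise positive) for a reference height $\eta_0$ and parameters $\tilde\alpha\ge0$, $\tilde\beta,\tilde\gamma\in\mathbb R$, one sets componentwise $\boldsymbol{\hat\alpha}^2=\tilde\alpha\sqrt{g\boldsymbol D}\,\boldsymbol D^2$ (with $\boldsymbol{\hat\alpha}\ge 0$), $\boldsymbol{\hat\beta}=\tilde\beta\boldsymbol D^3$, $\boldsymbol{\hat\gamma}=\tilde\gamma\sqrt{g\boldsymbol D}\,\boldsymbol D^3$. These are constant in time. The system is a semidiscretization, with periodic boundary conditions, of the dispersive shallow water model of Svärd and Kalisch, with water height $h$, velocity $v$, bathymetry $b$. *)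

(* Defs.v *)
From HB Require Import structures.
From mathcomp Require Import all_boot all_order all_algebra.
From mathcomp Require Import all_classical all_reals all_analysis.

Set Implicit Arguments.
Unset Strict Implicit.
Unset Printing Implicit Defensive.

Import Order.TTheory GRing.Theory Num.Theory.
Import numFieldNormedType.Exports.

Local Open Scope classical_set_scope.
Local Open Scope ring_scope.

Reserved Notation "u ** v" (at level 40, left associativity).
Reserved Notation "u ^^ k" (at level 29, left associativity).

Section Vectors.
Context {R : realType} {N : nat}.
Implicit Types (u v : 'cV[R]_N) (M : 'M[R]_N).

Definition vmul u v : 'cV[R]_N := map2_mx *%R u v.
Definition vexp u (k : nat) : 'cV[R]_N := map_mx (fun x => x ^+ k) u.
Definition vsqrt u : 'cV[R]_N := map_mx Num.sqrt u.

Definition vpos u : Prop := forall j, 0 < u j 0.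
Definition vnneg u : Prop := forall j, 0 <= u j 0.

Definition vtotal M u : R := ((const_mx 1 : 'cV[R]_N)^T *m M *m u) 0 0.

End Vectors.

Notation "u ** v" := (vmul u v) : ring_scope.
Notation "u ^^ k" := (vexp u k) : ring_scope.

Section SBP.
Context {R : realType} {N : nat}.
Implicit Types (x : 'cV[R]_N) (A M : 'M[R]_N).

Definition sym_posdef M : Prop :=
  M^T = M /\ forall u : 'cV[R]_N, u != 0 -> 0 < (u^T *m M *m u) 0 0.

Definition consistent A : Prop :=
  A *m (const_mx 1 : 'cV[R]_N) = 0.

(* The grid x belongs to the data of an SBP operator, but it is not constrained:
   beyond [consistent], no order of accuracy on the grid is required. *)
Record periodic_sbp1 x (D1 M : 'M[R]_N) : Prop := PeriodicSBP1 {
  sbp1_consistent : consistent D1;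
  sbp1_mass : sym_posdef M;
  sbp1_parts : M *m D1 + D1^T *m M = 0 }.

Record periodic_sbp2 x (D2 M : 'M[R]_N) : Prop := PeriodicSBP2 {
  sbp2_consistent : consistent D2;
  sbp2_mass : sym_posdef M;
  sbp2_parts : M *m D2 = D2^T *m M }.

End SBP.

Section Time.
Context {R : realType}.

Definition open_interval (J : set R) : Prop := open J /\ is_interval J.

(* Meant for an open set J of times. *)
Definition C1_on (V : normedModType R) (J : set R) (f : R -> V) : Prop :=
  forall t, J t -> derivable f t 1 /\ {for t, continuous (derive1 f)}.

Definition conserved (J : set R) (q : R -> R) : Prop :=
  forall t, J t -> is_derive t 1 q 0.

End Time.

Section Semidiscretization.
Context {R : realType} {N : nat}.
Variables (D1 D2 : 'M[R]_N) (g : R) (b alpha beta gamma : 'cV[R]_N).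
Implicit Types (h v y vt : 'cV[R]_N).

Definition sk_y h : 'cV[R]_N :=
  alpha ** (D1 *m (alpha ** (D1 *m (h + b)))).

Definition sk_mass_rhs h v : 'cV[R]_N :=
  - (D1 *m (h ** v)) + D1 *m sk_y h.

Definition sk_momentum_rhs h v vt : 'cV[R]_N :=
  let y := sk_y h in
  - (2^-1 *: (D1 *m (h ** v ^^ 2) + h ** v ** (D1 *m v)
              + v ** (D1 *m (h ** v))))
  - g *: (h ** (D1 *m (h + b)))
  + 2^-1 *: (D1 *m (v ** y) + v ** (D1 *m y) + y ** (D1 *m v))
  + D1 *m (beta ** (D1 *m vt))
  + 2^-1 *: (D2 *m (gamma ** (D1 *m v)))
  + 2^-1 *: (D1 *m (gamma ** (D2 *m v))).

Record sk_solution (J : set R) (h v : R -> 'cV[R]_N) : Prop := SKSolution {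
  sk_h_C1 : C1_on J h;
  sk_v_C1 : C1_on J v;
  sk_h_pos : forall t, J t -> vpos (h t);
  sk_mass_eq : forall t, J t ->
    derive1 h t = sk_mass_rhs (h t) (v t);
  sk_momentum_eq : forall t, J t ->
    derive1 (fun s => h s ** v s) t = sk_momentum_rhs (h t) (v t) (derive1 v t) }.

Definition sk_entropy (M : 'M[R]_N) h v : R :=
  vtotal M (2^-1 *: (h ** v ^^ 2 + g *: h ^^ 2) + g *: (h ** b)
           + 2^-1 *: (beta ** (D1 *m v) ^^ 2)).

End Semidiscretization.

(* Main.v *)
(** For a diagonal mass matrix, the form [<u, w> = vtotal M (u ** w)] is
    symmetric, and componentwise products can be moved between its arguments.
    With respect to it [D1] is skew-adjoint and [D2] is self-adjoint, and both
    annihilate constants, so [vtotal M] vanishes on their ranges; this gives the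
    mass balance and, after pairing the split-form products, the discharge
    balance.  For the entropy, the chain rule gives the rate
    [<v, P_t> - <v^2, h_t>/2 + g<h + b, h_t> + <D1 v, beta (D1 v_t)>].
    The advective terms cancel in skew-adjoint pairs, the pressure term cancels
    the flux part of [g<h + b, h_t>], the beta term of the momentum equation
    cancels the last summand, and the gamma terms cancel by commuting [D1] and
    [D2] across the form.  What remains of [y] is [- g<w, D1 w> = 0] with
    [w = alpha (D1 (h + b))]. *)

Require Import Defs.
From HB Require Import structures.
From mathcomp Require Import all_boot all_order all_algebra.
From mathcomp Require Import all_classical all_reals all_analysis.
From mathcomp Require Import ring lra.
Import Order.TTheory GRing.Theory Num.Theory.
Import numFieldNormedType.Exports.
Local Open Scope classical_set_scope.
Local Open Scope ring_scope.

(** * Componentwise products and mass-weighted totals *)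

Section VectorAlgebra.
Context {R : realType} {N : nat}.
Implicit Types (u v w : 'cV[R]_N) (A M : 'M[R]_N).

Lemma vmulE u v j : (u ** v) j 0 = u j 0 * v j 0.
Proof. by rewrite mxE. Qed.

Lemma vexpE u k j : (u ^^ k) j 0 = u j 0 ^+ k.
Proof. by rewrite mxE. Qed.

Lemma vmulC u v : u ** v = v ** u.
Proof. by apply/colP => j; rewrite !mxE mulrC. Qed.

Lemma vmulDr u v w : u ** (v + w) = u ** v + u ** w.
Proof. by apply/colP => j; rewrite !mxE mulrDr. Qed.

Lemma vmulNr u v : u ** (- v) = - (u ** v).
Proof. by apply/colP => j; rewrite !mxE mulrN. Qed.

Lemma vmulZr (c : R) u v : u ** (c *: v) = c *: (u ** v).
Proof. by apply/colP => j; rewrite !mxE mulrCA. Qed.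

Lemma vmul0r u : u ** 0 = 0.
Proof. by apply/colP => j; rewrite !mxE mulr0. Qed.

Lemma vmul0l u : 0 ** u = 0.
Proof. by apply/colP => j; rewrite !mxE mul0r. Qed.

Lemma vexp0 k : (0 : 'cV[R]_N) ^^ k.+1 = 0.
Proof. by apply/colP => j; rewrite !mxE expr0n. Qed.

Lemma vmul1l u : const_mx 1 ** u = u.
Proof. by apply/colP => j; rewrite !mxE mul1r. Qed.

Lemma vtotalD M u v : vtotal M (u + v) = vtotal M u + vtotal M v.
Proof. by rewrite /vtotal mulmxDr mxE. Qed.

Lemma vtotalN M u : vtotal M (- u) = - vtotal M u.
Proof. by rewrite /vtotal mulmxN mxE. Qed.

Lemma vtotal0 M : vtotal M 0 = 0.
Proof. by rewrite /vtotal mulmx0 mxE. Qed.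

Lemma vtotalZ M (c : R) u : vtotal M (c *: u) = c * vtotal M u.
Proof. by rewrite /vtotal -scalemxAr mxE. Qed.

(** With [M] diagonal both sides are the same weighted sum of [u_j w_j]; on the right, matrix
    identities for [M] can be applied. *)
Lemma vtotal_vmul M u w :
  is_diag_mx M -> vtotal M (u ** w) = (u^T *m M *m w) 0 0.
Proof.
move=> /diag_mxP[d ->]; rewrite /vtotal !mul_mx_diag !mxE.
by apply: eq_bigr => j _; rewrite !mxE mul1r; ring.
Qed.

Lemma consistent_const A (c : R) :
  consistent A -> A *m (const_mx c : 'cV[R]_N) = 0.
Proof.
move=> A1; have -> : const_mx c = c *: (const_mx 1 : 'cV[R]_N).
  by apply/colP => j; rewrite !mxE mulr1.
by rewrite -scalemxAr A1 scaler0.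
Qed.

End VectorAlgebra.

(** * Discrete integration by parts and the algebraic balances *)

Section SummationByParts.
Context {R : realType} {N : nat} (x : 'cV[R]_N) (D1 D2 M : 'M[R]_N).
Hypotheses (sbp1 : periodic_sbp1 x D1 M) (sbp2 : periodic_sbp2 x D2 M).
Hypothesis M_diag : is_diag_mx M.
Implicit Types u w : 'cV[R]_N.

Lemma vtotal_parts1 u w :
  vtotal M (u ** (D1 *m w)) = - vtotal M (D1 *m u ** w).
Proof.
have MD1 : M *m D1 = - (D1^T *m M).
  by apply/eqP; rewrite -addr_eq0 (sbp1_parts sbp1).
rewrite !vtotal_vmul // trmx_mul -mulmxA (mulmxA M) MD1.
by rewrite mulNmx mulmxN mxE !mulmxA.
Qed.

Lemma vtotal_parts2 u w :
  vtotal M (u ** (D2 *m w)) = vtotal M (D2 *m u ** w).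
Proof.
rewrite !vtotal_vmul // trmx_mul -mulmxA (mulmxA M) (sbp2_parts sbp2).
by rewrite !mulmxA.
Qed.

Lemma vtotal_D1 w : vtotal M (D1 *m w) = 0.
Proof.
by rewrite -[D1 *m w]vmul1l vtotal_parts1 (sbp1_consistent sbp1) vmul0l
  vtotal0 oppr0.
Qed.

Lemma vtotal_D2 w : vtotal M (D2 *m w) = 0.
Proof.
by rewrite -[D2 *m w]vmul1l vtotal_parts2 (sbp2_consistent sbp2) vmul0l
  vtotal0.
Qed.

Lemma vtotal_sk_mass_rhs b alpha h v :
  vtotal M (sk_mass_rhs D1 b alpha h v) = 0.
Proof. by rewrite vtotalD vtotalN !vtotal_D1 oppr0 addr0. Qed.

Lemma vtotal_sk_momentum_rhs g b0 alpha beta gamma h v vt :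
  vtotal M (sk_momentum_rhs D1 D2 g (const_mx b0)
    alpha beta gamma h v vt) = 0.
Proof.
rewrite /sk_momentum_rhs /=; set y := sk_y _ _ _ _.
rewrite mulmxDr (consistent_const _ _ (sbp1_consistent sbp1)) addr0.
rewrite !(vtotalD, vtotalN, vtotalZ) !vtotal_D1 vtotal_D2.
have hvv := vtotal_parts1 (h ** v) v.
(* Skew-adjointness with equal arguments makes this total its own negative. *)
have hh : vtotal M (h ** (D1 *m h)) = 0.
  by have := vtotal_parts1 h h; rewrite [D1 *m _ ** _]vmulC; lra.
have vy := vtotal_parts1 v y.
rewrite hh; rewrite [D1 *m _ ** v]vmulC in hvv.
rewrite [_ *m v ** y]vmulC in vy.
lra.
Qed.

(** Time does not enter: [vt] is an arbitrary vector, so the entropy balance is a purely algebraic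
    identity. *)
Lemma vtotal_sk_entropy_rate g b alpha beta gamma h v vt :
  let ht := sk_mass_rhs D1 b alpha h v in
  let Pt := sk_momentum_rhs D1 D2 g b alpha beta gamma h v vt in
  vtotal M (v ** Pt - 2^-1 *: (v ^^ 2 ** ht) + g *: ((h + b) ** ht)
            + D1 *m v ** (beta ** (D1 *m vt))) = 0.
Proof.
rewrite /= /sk_momentum_rhs /sk_mass_rhs /=; set y := sk_y _ _ _ _.
rewrite !(vmulDr, vmulNr, vmulZr) !(vtotalD, vtotalN, vtotalZ, scalerDr).
set w := D1 *m (h + b).
have e1 := vtotal_parts1 v (h ** v ^^ 2).
have e2 := vtotal_parts1 (v ^^ 2) (h ** v).
have e3 := vtotal_parts1 v (v ** y).
have e4 := vtotal_parts1 v (beta ** (D1 *m vt)).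
have e5 := vtotal_parts1 v (gamma ** (D2 *m v)).
have e6 := vtotal_parts2 v (gamma ** (D1 *m v)).
have e7 := vtotal_parts1 (h + b) (h ** v).
have e8 := vtotal_parts1 (h + b) y.
have e9 : vtotal M (alpha ** w ** (D1 *m (alpha ** w))) = 0.
  have := vtotal_parts1 (alpha ** w) (alpha ** w).
  rewrite [D1 *m _ ** _]vmulC; lra.
(* The [f] identities reorder componentwise factors so that cancelling totals become literally
   equal; what remains is linear in them. *)
have f1 : v ** (h ** v ** (D1 *m v)) = D1 *m v ** (h ** v ^^ 2).
  by apply/colP => j; rewrite !(vmulE, vexpE); ring.
have f2 : v ** (v ** (D1 *m (h ** v))) = v ^^ 2 ** (D1 *m (h ** v)).
  by apply/colP => j; rewrite !(vmulE, vexpE); ring.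
have f3 : v ** (v ** (D1 *m y)) = v ^^ 2 ** (D1 *m y).
  by apply/colP => j; rewrite !(vmulE, vexpE); ring.
have f4 : v ** (y ** (D1 *m v)) = D1 *m v ** (v ** y).
  by apply/colP => j; rewrite !(vmulE, vexpE); ring.
have f5 : D1 *m v ** (gamma ** (D2 *m v)) = D2 *m v ** (gamma ** (D1 *m v)).
  by apply/colP => j; rewrite !(vmulE, vexpE); ring.
have f6 : v ** (h ** w) = w ** (h ** v).
  by apply/colP => j; rewrite !(vmulE, vexpE); ring.
(* Splitting the outer [alpha] off [y] exposes the vanishing total [e9]. *)
have f7 : w ** y = alpha ** w ** (D1 *m (alpha ** w)).
  by apply/colP => j; rewrite !(vmulE, vexpE) -/w; ring.
rewrite f1 f2 f3 f4 f6.
rewrite -/w f7 e9 in e8; rewrite -/w in e7; rewrite f5 in e5.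
rewrite e7 e8; lra.
Qed.

End SummationByParts.

(** * Product and chain rules for vector-valued functions of time *)

Section TimeDerivatives.
Context {R : realType}.

Lemma is_derive_colP {n : nat} (f : R -> 'cV[R]_n) (t : R) (df : 'cV[R]_n) :
  is_derive t 1 f df <->
  forall j, is_derive t 1 (fun s => f s j 0) (df j 0).
Proof.
split=> [[fd fE] j|fd].
  split; first by move/derivable_mxP: fd; exact.
  by rewrite -fE derive_mx // mxE.
have df' : derivable f t 1.
  by apply/derivable_mxP => i j; rewrite ord1; case: (fd i).
split=> //; rewrite derive_mx //; apply/colP => j; rewrite mxE.
by case: (fd j).
Qed.

Lemma is_derive_vmul {n : nat} (f k : R -> 'cV[R]_n) (t : R)
    (df dk : 'cV[R]_n) :
  is_derive t 1 f df -> is_derive t 1 k dk ->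
  is_derive t 1 (fun s => f s ** k s) (df ** k t + f t ** dk).
Proof.
move=> /is_derive_colP fd /is_derive_colP kd; apply/is_derive_colP => j.
rewrite (_ : (fun _ => _) = (fun s => f s j 0) * (fun s => k s j 0));
  last first.
  by apply/funext => s; rewrite vmulE.
apply: is_derive_eq (is_deriveM (fd j) (kd j)) _.
by rewrite !mxE /GRing.scale /=; ring.
Qed.

Lemma is_derive_mulmx {m n : nat} (A : 'M[R]_(m, n)) (f : R -> 'cV[R]_n)
    (t : R) (df : 'cV[R]_n) :
  is_derive t 1 f df -> is_derive t 1 (fun s => A *m f s) (A *m df).
Proof.
move=> /is_derive_colP fd; apply/is_derive_colP => i.
rewrite (_ : (fun _ => _) = \sum_(j < n) (A i j \*: (fun s => f s j 0))).
  by rewrite mxE; apply: is_derive_sum => j; exact: is_deriveZ.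
by apply/funext => s; rewrite mxE fct_sumE.
Qed.

Lemma is_derive_vtotal {n : nat} (M : 'M[R]_n) (f : R -> 'cV[R]_n) (t : R)
    (df : 'cV[R]_n) :
  is_derive t 1 f df -> is_derive t 1 (fun s => vtotal M (f s)) (vtotal M df).
Proof.
by move=> /(is_derive_mulmx (_ *m M)) /is_derive_colP; exact.
Qed.

(** The kinetic part is written through the discharge, using
    [(h v^2)_t / 2 = v (h v)_t - v^2 h_t / 2], so that both evolution equations can be
    substituted. *)
Lemma is_derive_sk_entropy {n : nat} (D1 M : 'M[R]_n) (g : R)
    (b beta : 'cV[R]_n) (h v : R -> 'cV[R]_n) (t : R) (ht vt : 'cV[R]_n) :
  is_derive t 1 h ht -> is_derive t 1 v vt ->
  is_derive t 1 (fun s => sk_entropy D1 g b beta M (h s) (v s))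
    (vtotal M (v t ** (ht ** v t + h t ** vt) - 2^-1 *: (v t ^^ 2 ** ht)
               + g *: ((h t + b) ** ht)
               + D1 *m v t ** (beta ** (D1 *m vt)))).
Proof.
move=> hd vd; apply: is_derive_vtotal.
have sqE (u : 'cV[R]_n) : u ^^ 2 = u ** u.
  by apply/colP => j; rewrite vmulE vexpE expr2.
have cd (c : 'cV[R]_n) : is_derive t 1 (fun=> c) 0 by exact: is_derive_cst.
have Dvd := is_derive_mulmx D1 _ _ _ vd.
under eq_fun do rewrite !sqE.
have d1 := @is_deriveZ _ _ _ _ 2^-1 _ _ _ (is_deriveD
  (is_derive_vmul _ _ _ _ _ hd (is_derive_vmul _ _ _ _ _ vd vd))
  (@is_deriveZ _ _ _ _ g _ _ _ (is_derive_vmul _ _ _ _ _ hd hd))).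
have d2 := @is_deriveZ _ _ _ _ g _ _ _ (is_derive_vmul _ _ _ _ _ hd (cd b)).
have d3 := @is_deriveZ _ _ _ _ 2^-1 _ _ _ (is_derive_vmul _ _ _ _ _ (cd beta)
  (is_derive_vmul _ _ _ _ _ Dvd Dvd)).
apply: is_derive_eq (is_deriveD (is_deriveD d1 d2) d3) _.
(* Naming the matrix products keeps [mxE] from expanding them into sums, so [field] treats their
   entries as atoms. *)
apply/colP => j; set Dv := D1 *m v t; set Dvt := D1 *m vt.
by rewrite !mxE; field.
Qed.

Lemma C1_on_is_derive {V : normedModType R} (J : set R) (f : R -> V) (t : R) :
  C1_on J f -> J t -> is_derive t 1 f (derive1 f t).
Proof. by move=> fC1 /fC1[fd _]; rewrite derive1E; exact: derivableP. Qed.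

Lemma C1_on_cst {V : normedModType R} (J : set R) (c : V) : C1_on J (fun=> c).
Proof.
move=> t _; split; first exact: derivable_cst.
rewrite (_ : derive1 _ = cst 0); first exact: cvg_cst.
by apply/funext => s; rewrite derive1_cst.
Qed.

End TimeDerivatives.

(** * Well-balancedness and the conservation laws *)

Lemma sk_lake_at_rest (R : realType) (N : nat) (D1 D2 : 'M[R]_N) (g : R)
    (b alpha beta gamma : 'cV[R]_N) (c : R) (h0 : 'cV[R]_N) :
  consistent D1 -> vpos h0 -> h0 + b = const_mx c ->
  sk_solution D1 D2 g b alpha beta gamma setT (fun=> h0) (fun=> 0).
Proof.
move=> D1_cst h0_gt0 h0b.
(* A flat surface kills the pressure term and [y]; every other term contains [v] or its time
   derivative. *)
have Dhb : D1 *m (h0 + b) = 0 by rewrite h0b consistent_const.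
have y0 : sk_y D1 b alpha h0 = 0 by rewrite /sk_y Dhb !(vmul0r, mulmx0).
split; [exact: C1_on_cst | exact: C1_on_cst | by [] | |] => t _.
  by rewrite derive1_cst /sk_mass_rhs y0 vmul0r mulmx0 oppr0 addr0.
rewrite (_ : (fun _ => _) = cst 0); last by apply/funext => s; rewrite vmul0r.
rewrite !derive1_cst /sk_momentum_rhs Dhb y0.
by rewrite !(vexp0, vmul0l, vmul0r, mulmx0, addr0, scaler0, oppr0).
Qed.

Theorem theorem3p11 (R : realType) (N : nat)
  (x : 'cV[R]_N) (D1 D2 M : 'M[R]_N)
  (sbp1 : periodic_sbp1 x D1 M) (sbp2 : periodic_sbp2 x D2 M)
  (M_diag : is_diag_mx M)
  (g : R) (g_gt0 : 0 < g)
  (b : 'cV[R]_N) (eta0 : R) (D : 'cV[R]_N)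
  (D_def : D = const_mx eta0 - b) (D_gt0 : vpos D)
  (alphat betat gammat : R) (alphat_ge0 : 0 <= alphat)
  (alpha beta gamma : 'cV[R]_N)
  (alpha_ge0 : vnneg alpha)
  (alpha_def : alpha ^^ 2 = alphat *: (vsqrt (g *: D) ** D ^^ 2))
  (beta_def : beta = betat *: D ^^ 3)
  (gamma_def : gamma = gammat *: (vsqrt (g *: D) ** D ^^ 3)) :
  (forall (J : set R) (h v : R -> 'cV[R]_N),
     open_interval J ->
     sk_solution D1 D2 g b alpha beta gamma J h v ->
     [/\ conserved J (fun t => vtotal M (h t)),
         forall b0 : R, b = const_mx b0 ->
           conserved J (fun t => vtotal M (h t ** v t)) &
         conserved J (fun t => sk_entropy D1 g b beta M (h t) (v t))])
  /\
  (forall (c : R) (h0 : 'cV[R]_N),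
     vpos h0 -> h0 + b = const_mx c ->
     sk_solution D1 D2 g b alpha beta gamma setT (fun=> h0) (fun=> 0)).
Proof.
split=> [J h v _ sol|c h0]; last first.
  exact: sk_lake_at_rest (sbp1_consistent sbp1).
have hd t (Jt : J t) := C1_on_is_derive _ _ _ (sk_h_C1 sol) Jt.
have vd t (Jt : J t) := C1_on_is_derive _ _ _ (sk_v_C1 sol) Jt.
have Pd t (Jt : J t) := is_derive_vmul _ _ _ _ _ (hd t Jt) (vd t Jt).
(* The scheme prescribes the derivative of the product [h v]; uniqueness of derivatives identifies
   it with the product-rule expression that the entropy rate contains. *)
have PtE t (Jt : J t) :
    derive1 h t ** v t + h t ** derive1 v t =
    sk_momentum_rhs D1 D2 g b alpha beta gamma (h t) (v t) (derive1 v t).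
  by rewrite -(sk_momentum_eq sol) // [RHS]derive1E; have [_ ->] := Pd t Jt.
split=> [t Jt|b0 bE t Jt|t Jt].
- apply: is_derive_eq (is_derive_vtotal M _ _ _ (hd t Jt)) _.
  by rewrite (sk_mass_eq sol) // (vtotal_sk_mass_rhs _ _ _ sbp1).
- apply: is_derive_eq (is_derive_vtotal M _ _ _ (Pd t Jt)) _.
  by rewrite PtE // bE (vtotal_sk_momentum_rhs _ _ _ _ sbp1 sbp2).
- apply: is_derive_eq
    (is_derive_sk_entropy D1 M g b beta _ _ _ _ _ (hd t Jt) (vd t Jt)) _.
  rewrite PtE // (sk_mass_eq sol) //.
  by rewrite (vtotal_sk_entropy_rate _ _ _ _ sbp1 sbp2).
Qed.
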